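(* Let $G$ be a finite simple graph on $n$ vertices with $m$ edges, and let $\mu_1,\dots,\mu_n\in\mathbb{C}$ be the roots (with multiplicity) of its permanental polynomial $\pi(G,x)=\operatorname{per}(xI-A(G))$. Then \[ \mathcal{E}_{\mathrm{per}}(G)=\sum_{i=1}^n|\mu_i|\ \ge\ 2\sqrt{m}. \]
   Context: $A(G)$ is the adjacency matrix of $G$. For an $n\times n$ matrix $M=(m_{ij})$, $\operatorname{per}(M)=\sum_{\sigma\in S_n}\prod_{i=1}^n m_{i,\sigma(i)}$. The permanental polynomial $\pi(G,x)=\operatorname{per}(xI-A(G))$ is a monic polynomial of degree $n$; its roots $\mu_1,\dots,\mu_n$ (counted with multiplicity) are the permanental roots, and the permanental energy is $\mathcal{E}_{\mathrm{per}}(G)=\sum_{i=1}^n|\mu_i|$. *)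

(* Defs.v *)
From mathcomp Require Import all_boot all_order all_fingroup all_algebra.
From mathcomp Require Import reals complex.

Set Implicit Arguments.
Unset Strict Implicit.
Unset Printing Implicit Defensive.

Import GRing.Theory Num.Theory.
Local Open Scope ring_scope.
Local Open Scope complex_scope.

Record sgraph := SGraph {
  vertex :> finType;
  adj : rel vertex;
  adj_sym : symmetric adj;
  adj_irr : irreflexive adj
}.

Definition edge_set (G : sgraph) : {set {set G}} :=
  [set [set p.1; p.2] | p : G * G & adj p.1 p.2].

Definition permanent (S : comNzRingType) (n : nat) (M : 'M[S]_n) : S :=
  \sum_(s : 'S_n) \prod_(i < n) M i (s i).

(* The vertices are ordered by enum_val; another order would conjugate this
   matrix by a permutation matrix, which does not change permanents. *)
Definition adj_mx (S : comNzRingType) (G : sgraph) : 'M[S]_#|G| :=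
  \matrix_(i, j) (adj (enum_val i) (enum_val j))%:R.

Definition perm_poly (S : comNzRingType) (G : sgraph) : {poly S} :=
  permanent (char_poly_mx (adj_mx S G)).

(* The elements of R[i] such that
   p = lead_coef p *: \prod_(z <- perm_roots R G) ('X - z%:P)
   for p := perm_poly R[i] G, each listed with its multiplicity. *)
Definition perm_roots (R : realType) (G : sgraph) : seq R[i] :=
  sval (closed_field_poly_normal (perm_poly R[i] G)).

(* The modulus is the R-valued Normc.normc; `|z| would lie in R[i]. *)
Definition perm_energy (R : realType) (G : sgraph) : R :=
  \sum_(z <- perm_roots R G) Normc.normc z.

(* Main.v *)
(* Expanding [per(xI - A)] over permutations, a permutation moving k points
   contributes to the coefficient of x^(n-k).  No permutation moves exactly one
   point, and those moving two points are transpositions, so the polynomial is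
   x^n + m x^(n-2) + ...  Thus the roots have e_1 = 0 and e_2 = m, whence
   p_2 = -2m, and (sum |mu_i|)^2 >= |p_2| + 2 |e_2| = 4m. *)
Require Import Defs.
From mathcomp Require Import all_boot all_order all_fingroup all_algebra.
From mathcomp Require Import reals complex ring zify.

Import Order.TTheory GRing.Theory Num.Theory.
Local Open Scope ring_scope.
Local Open Scope complex_scope.

(* Multiplying by ['X^2] lets the two coefficients below the leading one be
   read off at positive indices, whatever the degree. *)
Lemma coef_prod_XsubC_MX2 (R : comNzRingType) (I : Type) (s : seq I) (f : I -> R) :
  let P := \prod_(i <- s) ('X - (f i)%:P) * 'X^2 in
  [/\ P`_(size s).+2 = 1,
      P`_(size s).+1 = - \sum_(i <- s) f i &
      P`_(size s) *+ 2 = (\sum_(i <- s) f i) ^+ 2 - \sum_(i <- s) f i ^+ 2].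
Proof.
elim: s => [|a s IH] /=.
  by rewrite !big_nil mul1r !coefXn oppr0 expr0n addr0 mul0rn.
rewrite !big_cons -mulrA mulrBl !coefB !coefXM !coefCM /=.
move: IH; set P := (_ * 'X^2) => -[P2 P1 P0].
(* [P] has degree [size s + 2], so this index is one past its leading term. *)
have P3 : P`_(size s).+3 = 0.
  apply: nth_default; rewrite size_mulXn; last first.
    exact/monic_neq0/monic_prod_XsubC.
  by rewrite size_prod_XsubC.
split; first by rewrite P3 mulr0 subr0.
  by rewrite P2 P1 mulr1 opprD addrC.
rewrite P1 mulrN opprK mulrnDl P0.
ring.
Qed.

Definition moved (T : finType) (s : {perm T}) : {set T} := [set i | s i != i].
Arguments moved {T}.

(** By injectivity the image of a moved point is moved too, so a sole moved point would be its own
    image. *)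
Lemma card_moved_neq1 (T : finType) (s : {perm T}) : #|moved s| != 1%N.
Proof.
apply/negP => /cards1P[x Mx].
have : s x \in moved s.
  by rewrite inE (inj_eq perm_inj); have := set11 x; rewrite -Mx inE.
have := set11 x; rewrite -Mx inE => sx.
by rewrite Mx inE (negbTE sx).
Qed.

Lemma moved_tperm (T : finType) (x y : T) :
  x != y -> moved (tperm x y) = [set x; y].
Proof.
move=> xy; apply/setP => z; rewrite !inE.
case: tpermP => [->|->|/eqP/negbTE-> /eqP/negbTE->]; rewrite ?eqxx ?orbT //.
  by rewrite eq_sym xy.
Qed.

(** The image of [x] is moved and differs from [x], so it can only be [y]; symmetrically for [y]. *)
Lemma moved2P (T : finType) (s : {perm T}) x y :
  x != y -> moved s = [set x; y] -> s = tperm x y.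
Proof.
move=> xy Ms; have M z : (s z != z) = (z == x) || (z == y).
  by have := in_set2 z x y; rewrite -Ms inE.
have sx : s x = y.
  have: s (s x) != s x by rewrite (inj_eq perm_inj) M eqxx.
  have: s x != x by rewrite M eqxx.
  by rewrite [s (s x) != _]M => /negbTE-> /eqP.
have sy : s y = x.
  have: s (s y) != s y by rewrite (inj_eq perm_inj) M eqxx orbT.
  have: s y != y by rewrite M eqxx orbT.
  by rewrite [s (s y) != _]M => /negbTE->; rewrite orbF => /eqP.
apply/permP => z; case: tpermP => [->|->|/eqP zx /eqP zy] //.
by apply/eqP/negPn; rewrite M (negbTE zx) (negbTE zy).
Qed.

(** As the diagonal of [A] vanishes, each fixed point contributes a factor ['X] and each moved point
    a constant. *)
Lemma permanent_char_poly_mx (S : comNzRingType) (n : nat) (A : 'M[S]_n) :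
  (forall i, A i i = 0) ->
  permanent (char_poly_mx A) =
  \sum_(s : 'S_n) (\prod_(i in moved s) - A i (s i)) *: 'X^(n - #|moved s|).
Proof.
move=> A0; apply: eq_bigr => s _.
rewrite (bigID [in moved s]) /= -mul_polyC rmorph_prod; congr (_ * _).
  apply: eq_bigr => i; rewrite inE => /negbTE si.
  by rewrite !mxE eq_sym si mulr0n sub0r /= polyCN.
under eq_bigr => i; first rewrite inE negbK => /eqP si.
  rewrite !mxE si eqxx mulr1n A0 subr0.
  over.
rewrite prodr_const; congr (_ ^+ _).
by rewrite -[X in (X - _)%N](card_ord n) -(cardC (mem (moved s))) addKn.
Qed.

Lemma coef_permanent_char_poly_mx_MX2 (S : comNzRingType) (n : nat)
    (A : 'M[S]_n) (k : nat) :
  (forall i, A i i = 0) -> (k <= n.+2)%N ->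
  (permanent (char_poly_mx A) * 'X^2)`_(n.+2 - k) =
  \sum_(s : 'S_n | #|moved s| == k) \prod_(i in moved s) - A i (s i).
Proof.
move=> A0 kn; rewrite permanent_char_poly_mx // mulr_suml.
under eq_bigr do rewrite -scalerAl -exprD.
(* The exponents [n - c + 2] and [n + 2 - k] agree exactly when [c = k], since neither truncated
   subtraction is cut off at 0. *)
rewrite coef_sumMXn; apply: eq_bigl => s /=.
have := max_card (moved s); rewrite card_ord => le_n.
by move: le_n; set c := #|_|; lia.
Qed.

(** These transpositions of adjacent vertices are the permutations behind the coefficient [m]. *)
Definition edge_perms (G : sgraph) : {set 'S_#|G|} :=
  [set s | (#|moved s| == 2) &&
     [forall i in moved s, adj (enum_val i) (enum_val (s i))]].

Lemma tperm_edge_perms (G : sgraph) (x y : 'I_#|G|) : x != y ->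
  (tperm x y \in edge_perms G) = adj (enum_val x) (enum_val y).
Proof.
move=> xy; rewrite inE moved_tperm // cards2 xy.
apply/forall_inP/idP => [/(_ x (set21 x y))|axy i]; first by rewrite tpermL.
rewrite !inE => /orP[]/eqP->; first by rewrite tpermL.
by rewrite tpermR adj_sym.
Qed.

Lemma edge_permP (G : sgraph) (s : 'S_#|G|) :
  reflect (exists x y, [/\ x != y, s = tperm x y & adj (enum_val x) (enum_val y)])
    (s \in edge_perms G).
Proof.
apply: (iffP idP) => [|[x [y [xy -> axy]]]]; last by rewrite tperm_edge_perms.
move=> Es; have /andP[/cards2P[x [y [xy /(moved2P _ _ _ _ xy) def_s]]] _] :
  (#|moved s| == 2) && (s \in edge_perms G).
  by rewrite Es; move: Es; rewrite inE => /andP[->].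
by exists x, y; rewrite -tperm_edge_perms -?def_s.
Qed.

(** A transposition is determined by the pair of points it moves, so [h] matches these permutations
    with the edges. *)
Lemma card_edge_perms (G : sgraph) : #|edge_perms G| = #|edge_set G|.
Proof.
pose h (s : 'S_#|G|) : {set G} := enum_val @: moved s.
have h_inj : {in edge_perms G &, injective h}.
  move=> s t /edge_permP[x [y [xy -> _]]] /edge_permP[z [w [zw -> _]]].
  move/(imset_inj enum_val_inj); rewrite moved_tperm // => Mt.
  by apply/esym/moved2P.
rewrite -(card_in_imset h_inj); apply: eq_card => e.
have hE x y : x != y -> h (tperm x y) = [set enum_val x; enum_val y].
  by move=> xy; rewrite /h moved_tperm // imsetU1 imset_set1.
apply/imsetP/imsetP => [[s /edge_permP[x [y [xy -> axy]]] ->]|[[u v] /= auv ->]].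
  by exists (enum_val x, enum_val y); rewrite ?hE ?inE.
have uv : enum_rank u != enum_rank v.
  rewrite (inj_eq enum_rank_inj); apply: contraTneq auv => ->.
  by rewrite inE adj_irr.
exists (tperm (enum_rank u) (enum_rank v)); last by rewrite hE // !enum_rankK.
apply/edge_permP; exists (enum_rank u), (enum_rank v).
by rewrite !enum_rankK; move: auv; rewrite inE.
Qed.

Lemma coef_perm_poly_MX2 (S : comNzRingType) (G : sgraph) :
  (perm_poly S G * 'X^2)`_(#|G|.+1) = 0 /\
  (perm_poly S G * 'X^2)`_#|G| = #|edge_set G|%:R.
Proof.
have A0 i : adj_mx S G i i = 0 by rewrite mxE adj_irr.
split.
  have -> : (#|G|.+1 = #|G|.+2 - 1)%N by lia.
  rewrite coef_permanent_char_poly_mx_MX2 // big_pred0 // => s.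
  exact/negbTE/card_moved_neq1.
have -> : (perm_poly S G * 'X^2)`_#|G| = (perm_poly S G * 'X^2)`_(#|G|.+2 - 2).
  by congr (_`__); lia.
rewrite coef_permanent_char_poly_mx_MX2 // -card_edge_perms -sum1_card natr_sum.
rewrite big_mkcond [RHS]big_mkcond; apply: eq_bigr => s _ /=.
case: ifPn => [/cards2P[x [y [xy Ms]]]|neq2]; last first.
  by rewrite inE (negbTE neq2).
rewrite Ms (moved2P _ _ _ _ xy Ms) tperm_edge_perms //.
(* The two signs cancel, and the product of the two symmetric 0/1 entries is that entry itself. *)
rewrite big_setU1 ?inE //= big_set1 tpermL tpermR mulrNN !mxE.
by rewrite [adj (enum_val y) _]adj_sym; case: adj; rewrite ?mulr1 ?mulr0.
Qed.

Lemma sqr_sum_split (R : comNzRingType) (I : finType) (f : I -> R) :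
  (\sum_i f i) ^+ 2 =
  \sum_i f i ^+ 2 + \sum_i \sum_(j | j != i) f i * f j.
Proof.
rewrite expr2 big_distrlr -big_split; apply: eq_bigr => i _ /=.
by rewrite (bigD1 i).
Qed.

Lemma normc_ge0 (R : rcfType) (z : R[i]) : 0 <= Normc.normc z.
Proof. by rewrite -ler0c; exact: (normr_ge0 z). Qed.

Theorem theorem3p1 (R : realType) (G : sgraph) (n m : nat)
    (hn : #|G| = n) (hm : #|edge_set G| = m) (mu : 'I_n -> R[i])
    (hmu : perm_poly R[i] G = \prod_(i < n) ('X - (mu i)%:P)) :
  perm_energy R G = \sum_(i < n) Normc.normc (mu i) /\
  2 * Num.sqrt m%:R <= \sum_(i < n) Normc.normc (mu i).
Proof.
subst n m; split.
  (* Both lists of roots factor the same monic polynomial, so they agree up to order. *)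
  rewrite /perm_energy /perm_roots; case: closed_field_poly_normal => /= r.
  rewrite hmu (monicP (monic_prod_XsubC _ _ _)) scale1r.
  rewrite -(big_map mu xpredT (fun z => 'X - z%:P)) => /prod_XsubC_eq eq_r.
  by rewrite -(big_map mu xpredT (@Normc.normc R)); apply/esym/perm_big.
have [c1 c0] := coef_perm_poly_MX2 R[i] G.
have := coef_prod_XsubC_MX2 R[i] _ (index_enum 'I_#|G|) mu.
have -> : size (index_enum 'I_#|G|) = #|G|.
  by rewrite -sum1_size sum1_card card_ord.
rewrite -hmu /= c1 c0; case=> _ /esym/eqP; rewrite oppr_eq0 => /eqP e1.
rewrite e1 expr0n sub0r => e2.
have p2 : \sum_i mu i ^+ 2 = - (#|edge_set G|%:R *+ 2) by rewrite e2 opprK.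
(* The sum runs over ordered pairs, hence equals [2 e_2]; it is what remains of [e_1 ^+ 2 = 0] once
   [p_2] is split off. *)
have q2 : \sum_i \sum_(j | j != i) mu i * mu j = #|edge_set G|%:R *+ 2.
  by apply/eqP; rewrite e2 -addr_eq0 addrC -sqr_sum_split e1 expr0n.
(* In the expanded square, the triangle inequality bounds the diagonal part below by [|p_2|] and the
   rest by [|2 e_2|], each equal to [2m]. *)
have le4m : #|edge_set G|%:R *+ 4 <= (\sum_i `|mu i|) ^+ 2.
  rewrite sqr_sum_split (_ : 4 = 2 + 2)%N // mulrnDr; apply: lerD.
    rewrite -[leLHS]ger0_norm ?mulrn_wge0 // -normrN -p2.
    apply: le_trans (ler_norm_sum _ _ _) _.
    by apply: ler_sum => i _; rewrite normrX.
  rewrite -[leLHS]ger0_norm ?mulrn_wge0 // -q2.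
  apply: le_trans (ler_norm_sum _ _ _) _; apply: ler_sum => i _.
  apply: le_trans (ler_norm_sum _ _ _) _; apply: ler_sum => j _.
  by rewrite normrM.
have sum_ge0 : 0 <= \sum_i Normc.normc (mu i).
  by apply: sumr_ge0 => i _; apply: normc_ge0.
rewrite -ler_sqr ?nnegrE ?mulr_ge0 ?sqrtr_ge0 // exprMn sqr_sqrtr //.
(* The squared inequality is moved from [R] into [R[i]], where [le4m] is stated. *)
rewrite -natrX mulr_natl -lecR rmorphMn rmorph_nat rmorphXn rmorph_sum.
exact: le4m.
Qed.
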